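(* Let $H$ be a complex Hilbert space and let $A,B$ and $T$ be not necessarily bounded operators in $H$. Assume that $B$ is normal, that $A$ is symmetric and invertible (hence $A$ is self-adjoint) and that $T$ is self-adjoint. Then \[T\subset AB\Longrightarrow T=AB.\]
   Context: Operators are linear, not necessarily bounded, with domain $D(\cdot)\subset H$ a linear subspace. $B(H)$ is the set of bounded operators defined on all of $H$. $S\subset T$ means $D(S)\subset D(T)$ and $Sx=Tx$ for all $x\in D(S)$. The product $ST$ has domain $D(ST)=\{x\in D(T): Tx\in D(S)\}$ and $(ST)x=S(Tx)$. An operator $A$ is invertible if there is an operator $C\in B(H)$ (written $A^{-1}=C$) with $CA\subset I$ and $AC=I$, where $I$ is the identity on $H$. A densely defined operator $S$ is symmetric if $S\subset S^*$ and self-adjoint if $S=S^*$. $S$ is normal if it is densely defined, closed and $SS^*=S^*S$ (equality including domains). *)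

(* Defs.v *)
From HB Require Import structures.
From mathcomp Require Import all_boot all_order all_algebra.
From mathcomp Require Import complex.
From mathcomp Require Import all_classical all_reals all_analysis.
Set Implicit Arguments.
Unset Strict Implicit.
Unset Printing Implicit Defensive.
Import Order.TTheory GRing.Theory Num.Theory Num.Def.
Import numFieldNormedType.Exports.
Local Open Scope classical_set_scope.
Local Open Scope complex_scope.
Local Open Scope ring_scope.

(* The scalars are R[i], the complex numbers over an arbitrary model R of the
   reals.  The inner product is linear on the left and conjugate-linear on the
   right, and it induces the (complete) norm; the norm of MathComp-Analysis
   takes its values in R[i], hence the equation inner_norm in R[i]. *)
HB.mixin Record CompleteNormedModule_isHilbert (R : realType) H
    of CompleteNormedModule R[i] H := {
  inner : {dot H for (@conjC R[i])} ;
  inner_norm : forall x : H, `|x| ^+ 2 = inner x x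
}.

#[short(type="hilbertType")]
HB.structure Definition Hilbert (R : realType) :=
  {H of CompleteNormedModule R[i] H & CompleteNormedModule_isHilbert R H}.

Local Notation "''[' u , v ]" := (inner u%R v%R) : ring_scope.

(* The values of app outside dom are irrelevant: op_sub and op_eq do not look
   at them. *)
Record operator (R : realType) (H : hilbertType R) := Operator {
  dom : set H ;
  app :> H -> H ;
  dom0 : dom 0 ;
  dom_lin : forall (a : R[i]) x y, dom x -> dom y -> dom (a *: x + y) ;
  app_lin : forall (a : R[i]) x y, dom x -> dom y ->
    app (a *: x + y) = a *: app x + app y
}.

Section Operators.
Variables (R : realType) (H : hilbertType R).
Implicit Types S T A C : operator H.

Definition op_sub S T := dom S `<=` dom T /\ forall x, dom S x -> S x = T x.

Definition op_eq S T := dom S = dom T /\ forall x, dom S x -> S x = T x.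

Lemma app0 S : S 0 = 0.
Proof.
have := app_lin (-1) (dom0 S) (dom0 S).
by rewrite scaler0 addr0 scaleN1r addNr.
Qed.

Definition op_id : operator H :=
  @Operator R H setT id I (fun _ _ _ _ _ => I) (fun _ _ _ _ _ => erefl).

Lemma comp_dom0 S T : [set x | dom T x /\ dom S (T x)] 0.
Proof. by split; [exact: dom0 | rewrite app0; exact: dom0]. Qed.

Lemma comp_dom_lin S T (D := [set x | dom T x /\ dom S (T x)]) (a : R[i]) x y :
  D x -> D y -> D (a *: x + y).
Proof.
move=> [Tx STx] [Ty STy]; split; first exact: dom_lin.
by rewrite app_lin //; exact: dom_lin.
Qed.

Lemma comp_app_lin S T (D := [set x | dom T x /\ dom S (T x)]) (a : R[i]) x y :
  D x -> D y -> S (T (a *: x + y)) = a *: S (T x) + S (T y).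
Proof. by move=> [Tx STx] [Ty STy]; rewrite !app_lin. Qed.

Definition op_comp S T : operator H :=
  Operator (comp_dom0 S T) (@comp_dom_lin S T) (@comp_app_lin S T).

Definition densely_defined S := dense (dom S).

Lemma inner_conj (x y : H) : '[x, y] = ('[y, x])^*%R.
Proof. by rewrite [LHS]hermitian_subproof expr0 mul1r. Qed.

Lemma inner_linr (a : R[i]) (x y z : H) :
  '[x, a *: y + z] = a^*%R * '[x, y] + '[x, z].
Proof. by rewrite linearD /= linearZr_LR. Qed.

Lemma inner_sqr_sub (x z : H) : '[x, z] = 0 -> `|z| ^+ 2 <= `|z - x| ^+ 2.
Proof.
move=> xz0; have zx0 : '[z, x] = 0 by rewrite inner_conj xz0 rmorph0.
rewrite !inner_norm linearBl /= !linearB /= xz0 zx0 subr0 oppr0 add0r opprK.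
by rewrite lerDl -inner_norm exprn_ge0.
Qed.

(* A vector orthogonal to a dense domain vanishes, so that the vector S^* y is
   unique. *)
Lemma dense_inner_inj S (z z' : H) : densely_defined S ->
  (forall x, dom S x -> '[x, z] = '[x, z']) -> z = z'.
Proof.
move=> dS zz'; apply/eqP; rewrite -subr_eq0; apply: contrapT => /negP w0.
set w := z - z' in w0.
have [|x [bx Sx]] := dS (ball w `|w|) _ (ball_open _ _).
  by exists w; apply: ballxx; rewrite normr_gt0.
have xw : '[x, w] = 0 by rewrite linearB /= zz' // subrr.
have := inner_sqr_sub xw.
rewrite ler_pXn2r ?nnegrE //; move: bx; rewrite -ball_normE /=.
by move=> /lt_le_trans h /h; rewrite ltxx.
Qed.

Definition adj_rel S (y z : H) :=
  forall x, dom S x -> '[S x, y] = '[x, z].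

Definition adj_dom S : set H := [set y | exists z, adj_rel S y z].

Definition adj_app S (y : H) : H := xget 0 [set z | adj_rel S y z].

Lemma adj_appP S y : adj_dom S y -> adj_rel S y (adj_app S y).
Proof.
by move=> [z yz]; exact: (@xgetPex _ 0 _ (ex_intro (adj_rel S y) z yz)).
Qed.

Lemma adj_rel_lin S (a : R[i]) y z y' z' :
  adj_rel S y z -> adj_rel S y' z' -> adj_rel S (a *: y + y') (a *: z + z').
Proof. by move=> yz yz' x Sx; rewrite !inner_linr yz // yz'. Qed.

Lemma adj_dom0 S : adj_dom S 0.
Proof. by exists 0 => x _; rewrite !linear0. Qed.

Lemma adj_dom_lin S (a : R[i]) x y :
  adj_dom S x -> adj_dom S y -> adj_dom S (a *: x + y).
Proof.
by move=> [u xu] [v yv]; exists (a *: u + v); exact: adj_rel_lin.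
Qed.

Lemma adj_app_lin S (dS : densely_defined S) (a : R[i]) x y :
  adj_dom S x -> adj_dom S y ->
  adj_app S (a *: x + y) = a *: adj_app S x + adj_app S y.
Proof.
move=> Sx Sy; apply: (dense_inner_inj dS) => u Su.
rewrite -(adj_appP (adj_dom_lin a Sx Sy)) //.
exact: (adj_rel_lin a (adj_appP Sx) (adj_appP Sy)).
Qed.

Definition adjoint S (dS : densely_defined S) : operator H :=
  Operator (adj_dom0 S) (@adj_dom_lin S) (adj_app_lin dS).

Definition closed_op S := closed [set p : H * H | dom S p.1 /\ p.2 = S p.1].

Definition symmetric_op S :=
  exists dS : densely_defined S, op_sub S (adjoint dS).

Definition self_adjoint S :=
  exists dS : densely_defined S, op_eq S (adjoint dS).

Definition normal_op S :=
  exists dS : densely_defined S,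
    closed_op S /\ op_eq (op_comp S (adjoint dS)) (op_comp (adjoint dS) S).

(* C belongs to B(H), the bounded operators defined on all of H. *)
Definition everywhere_bounded C :=
  dom C = setT /\ exists M : R, forall x : H, `|C x| <= M%:C * `|x|.

Definition invertible_op A :=
  exists C, [/\ everywhere_bounded C,
    op_sub (op_comp C A) op_id & op_eq (op_comp A C) op_id].

End Operators.

(* Main.v *)
From HB Require Import structures.
Require Import Defs.
From mathcomp Require Import all_boot all_order all_algebra.
From mathcomp Require Import complex.
From mathcomp Require Import all_classical all_reals all_analysis.
From mathcomp Require Import ring lra zify.
Set Implicit Arguments.
Unset Strict Implicit.
Unset Printing Implicit Defensive.
Import Order.TTheory GRing.Theory Num.Theory.
Import numFieldNormedType.Exports.
Local Open Scope classical_set_scope.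
Local Open Scope complex_scope.
Local Open Scope ring_scope.

(** Let C = A^-1, a bounded self-adjoint injective operator.  Since T is
    self-adjoint, A symmetric and T <= AB, every y in D(B^* ) satisfies
    <T t, C y> = <B t, y> = <t, B^* y> for t in D(T); hence C y is in D(T),
    and T <= AB gives C B^* <= B C.

    The heart of the proof is a Fuglede theorem for this relation, with B
    unbounded and C self-adjoint.  Put K = (1 + B^*B)^-1 = (1 + BB^* )^-1,
    which is obtained by projecting on the graph of B
    ([closed_graph_projection], [resolvent_exists]).  From B^k C = C B^*^k on
    the natural domains and |B^k x| = |B^*^k x| one gets
    |(1 + B^*B)^(m/2) C x|^2 <= M |(1 + B^*B)^(m/2) x|^2 for all m, with
    M = |C|^2, and by duality
      <K^m C z, C z> <= M <K^m z, z>   for all m and z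
    ([normal_res_form_le]).  So the conjugate of C by 1 + tK, t >= 0, is
    bounded with all its powers; as 1 + itK is unitary up to order t^2, the
    operators (1 + sK/n)^n C (1 - sK/n)^n are bounded on |s| <= r by
    a constant depending neither on r nor on n >= 16 r^2.  Each of their matrix
    coefficients is a polynomial in s whose linear coefficient is the one of
    KC - CK, so that Cauchy's estimate, as in Liouville's theorem, yields
    KC = CK ([commute_of_pow_le]).

    For x in the range of K, the vector w = B^*Cx - CBx then satisfies Bw = 0,
    and w is orthogonal to ker B = ker B^* (which C preserves), so that w = 0
    ([fuglede_resolvent]).

    Finally let x be in D(AB).  Since T is self-adjoint, T + i is onto, so there
    is x' in D(T) with (T + i)x' = (AB + i)x, and z = x - x' satisfies
    Bz = -iCz.  With the preceding identity at Kz this forces <KCz, Cz> = 0,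
    hence z = 0 and x is in D(T) ([intertwine_eigen]). *)

(** * The real inner product *)

Section RealInner.
Variables (R : realType) (H : hilbertType R).
Implicit Types (x y z : H) (a : R) (s : R[i]).

(** The real part of the inner product.  Working with it keeps the inequalities
    in the ordered field R, where scalar products with i recover the imaginary
    part ([innerE]). *)
Definition rinner x y : R := complex.Re (inner x y).

(** The squared norm, as an element of R. *)
Definition sqnorm x : R := rinner x x.

Lemma rinnerC x y : rinner x y = rinner y x.
Proof. by rewrite /rinner inner_conj; case: (inner y x). Qed.

Lemma rinnerDl x y z : rinner (x + y) z = rinner x z + rinner y z.
Proof. by rewrite /rinner linearDl raddfD. Qed.

Lemma rinnerDr x y z : rinner z (x + y) = rinner z x + rinner z y.
Proof. by rewrite !(rinnerC z) rinnerDl. Qed.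

Lemma rinnerZl a x y : rinner (a%:C *: x) y = a * rinner x y.
Proof.
rewrite /rinner linearZl_LR /=; case: (inner x y) => b c /=.
by ring.
Qed.

Lemma rinnerZr a x y : rinner x (a%:C *: y) = a * rinner x y.
Proof. by rewrite !(rinnerC x) rinnerZl. Qed.

Lemma rinnerNl x y : rinner (- x) y = - rinner x y.
Proof. by rewrite -scaleN1r -(rmorphN1 (real_complex R)) rinnerZl mulN1r. Qed.

Lemma rinnerNr x y : rinner x (- y) = - rinner x y.
Proof. by rewrite !(rinnerC x) rinnerNl. Qed.

Lemma rinner0l y : rinner 0 y = 0.
Proof. by rewrite -(scale0r 0) (rinnerZl 0) mul0r. Qed.

Lemma rinner0r y : rinner y 0 = 0.
Proof. by rewrite rinnerC rinner0l. Qed.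

Lemma rinneriZ x y : rinner ('i%C *: x) y = - rinner x ('i%C *: y).
Proof.
rewrite /rinner linearZl_LR linearZr_LR /=; case: (inner x y) => b c /=.
lra.
Qed.

Lemma innerE x y :
  inner x y = (rinner x y)%:C + 'i%C * (rinner x ('i%C *: y))%:C.
Proof.
rewrite [LHS]complexE /rinner.
rewrite [X in _ = _ + _ * (complex.Re X)%:C]linearZr_LR /=.
by case: (inner x y) => b c /=; congr (_ + _ * _%:C); lra.
Qed.

Lemma sqnormE x : (sqnorm x)%:C = `|x| ^+ 2.
Proof.
rewrite inner_norm; apply: RRe_real.
by rewrite -inner_norm realE exprn_ge0.
Qed.

Lemma sqnorm_ge0 x : 0 <= sqnorm x.
Proof. by rewrite -ler0c sqnormE exprn_ge0. Qed.

Lemma sqnorm_eq0 x : sqnorm x = 0 -> x = 0.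
Proof.
move=> x0; apply/eqP; rewrite -normr_eq0 -sqrf_eq0.
by rewrite -sqnormE x0.
Qed.

Lemma sqnormZ s x :
  sqnorm (s *: x) = (complex.Re s ^+ 2 + complex.Im s ^+ 2) * sqnorm x.
Proof.
apply: complexI; rewrite sqnormE normrZ exprMn -sqnormE.
by rewrite -add_Re2_Im2 -rmorphM.
Qed.

Lemma sqnormD x y : sqnorm (x + y) = sqnorm x + 2 * rinner x y + sqnorm y.
Proof. rewrite /sqnorm !(rinnerDl, rinnerDr) (rinnerC y x); ring. Qed.

Lemma sqnormB x y : sqnorm (x - y) = sqnorm x - 2 * rinner x y + sqnorm y.
Proof. rewrite sqnormD rinnerNr /sqnorm rinnerNl rinnerNr; ring. Qed.

(** The Cauchy-Schwarz inequality. *)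
Lemma rinner_sqr_le x y : rinner x y ^+ 2 <= sqnorm x * sqnorm y.
Proof.
have [y0|y0] := eqVneq (sqnorm y) 0.
  by rewrite (sqnorm_eq0 y0) rinner0r expr0n /= /sqnorm rinner0r mulr0.
have yp : 0 < sqnorm y by rewrite lt_def y0 sqnorm_ge0.
have := sqnorm_ge0 ((sqnorm y)%:C *: x - (rinner x y)%:C *: y).
rewrite sqnormB !sqnormZ rinnerZl rinnerZr /= => h.
have {h} : 0 <= sqnorm y * (sqnorm x * sqnorm y - rinner x y ^+ 2) by lra.
by rewrite pmulr_rge0 // subr_ge0.
Qed.

Lemma inner_eqP x y x' y' :
  rinner x y = rinner x' y' -> rinner x ('i%C *: y) = rinner x' ('i%C *: y') ->
  inner x y = inner x' y'.
Proof. by move=> h h'; rewrite !innerE h h'. Qed.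

Lemma rinner_eq0 x : (forall y, rinner x y = 0) -> x = 0.
Proof. by move=> h; apply: sqnorm_eq0; exact: h. Qed.

End RealInner.

(** * Projection on the graph of a closed operator *)

Section GraphProjection.
Variables (R : realType) (H : hilbertType R).
Implicit Types (x y w : H) (B : operator H).

Lemma normr_lt_sqnorm x (r : R) : 0 < r -> (`|x| < r%:C) = (sqnorm x < r ^+ 2).
Proof.
move=> r0; rewrite -ltcR sqnormE (rmorphXn (real_complex R)).
rewrite ltr_pXn2r // nnegrE.
by rewrite normr_ge0.
by have := ltW r0; rewrite -ler0c.
Qed.

Lemma cvg_sqnorm (x_ : nat -> H) y : x_ n @[n --> \oo] --> y ->
  forall e : R, 0 < e -> \forall n \near \oo, sqnorm (y - x_ n) < e.
Proof.
move=> xy e e0; have s0 : 0 < Num.sqrt e by rewrite sqrtr_gt0.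
have /cvgrPdist_lt /(_ (Num.sqrt e)%:C) := xy.
rewrite ltcR s0 => /(_ isT); apply: filterS => n.
by rewrite normr_lt_sqnorm // sqr_sqrtr ?ltW.
Qed.

Lemma sqnorm_cauchy (x_ : nat -> H) :
  (forall e : R, 0 < e ->
    exists N, forall n, (N <= n)%N -> sqnorm (x_ N - x_ n) < e) ->
  exists y, x_ n @[n --> \oo] --> y.
Proof.
move=> cx; exists (lim (x_ n @[n --> \oo])).
apply/cauchy_cvgP/cauchy_exP => e e0.
have [r r0 re] : exists2 r : R, 0 < r & e = r%:C.
  exists (complex.Re e); first by move: e0; rewrite ltcE => /andP[].
  by rewrite RRe_real // gtr0_real.
have [N hN] := cx _ (exprn_gt0 2 r0).
exists (x_ N); exists N => // n /= Nn.
by rewrite -ball_normE /= re normr_lt_sqnorm // hN.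
Qed.

Lemma opD B x y : dom B x -> dom B y -> dom B (x + y) /\ B (x + y) = B x + B y.
Proof.
move=> Bx By; rewrite -[x]scale1r; split; first exact: dom_lin.
by rewrite app_lin // !scale1r.
Qed.

Lemma opZ B s x : dom B x -> dom B (s *: x) /\ B (s *: x) = s *: B x.
Proof.
move=> Bx; rewrite -[s *: x]addr0; split; first exact: dom_lin (dom0 B).
by rewrite app_lin ?app0 ?addr0 //; exact: dom0.
Qed.

Lemma opB B x y : dom B x -> dom B y -> dom B (x - y) /\ B (x - y) = B x - B y.
Proof.
move=> Bx By; have [dN eN] := opZ (-1) By.
by move: (opD Bx dN); rewrite eN !scaleN1r.
Qed.

(** The point (y, B y) is the orthogonal projection of (u, 0) on the graph of B.
    It is the limit of a sequence which minimises the distance J to (u, 0). *)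
Lemma closed_graph_projection B : closed_op B ->
  forall u, exists2 y, dom B y &
    forall w, dom B w -> rinner (u - y) w = rinner (B y) (B w).
Proof.
move=> cB u; pose J x := sqnorm (u - x) + sqnorm (B x).
pose E := [set J x | x in dom B]; pose d := inf E.
have infE : has_inf E.
  split; first by exists (J 0), 0 => //; exact: dom0.
  by exists 0 => _ [x _ <-]; rewrite addr_ge0 ?sqnorm_ge0.
have dJ x : dom B x -> d <= J x.
  by move=> Bx; apply: ge_inf; [case: infE|exists x].
have /choice[x_ x_P] n : exists x, dom B x /\ J x < d + n.+1%:R^-1.
  have [|_ [x Bx <-] Jx] := @inf_adherent _ E n.+1%:R^-1 _ infE.
    by rewrite invr_gt0.
  by exists x.
(* The parallelogram identity at the midpoint makes the sequence Cauchy. *)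
have para x x' : dom B x -> dom B x' ->
    sqnorm (x - x') + sqnorm (B x - B x') <= 2 * J x + 2 * J x' - 4 * d.
  move=> Bx Bx'; have [Bm Bme] := opD Bx Bx'.
  have [Bh Bhe] := opZ (2^-1)%:C Bm.
  have := dJ _ Bh; rewrite /J Bhe Bme.
  have -> : u - (2^-1)%:C *: (x + x') = (2^-1)%:C *: ((u - x) + (u - x')).
    rewrite addrACA -opprD scalerBr; congr (_ - _).
    rewrite -mulr2n -[u *+ 2]scaler_nat scalerA.
    rewrite -(rmorph_nat (real_complex R)) -rmorphM /=.
    by rewrite mulVf ?scale1r // pnatr_eq0.
  have -> : x - x' = (u - x') - (u - x) by rewrite [RHS]addrC opprB subrKA.
  rewrite !sqnormZ /= (sqnormB (u - x')) (sqnormB (B x)) (sqnormD (u - x)).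
  rewrite (sqnormD (B x)) (rinnerC (u - x')); lra.
have small (e : R) : 0 < e -> exists N, forall n, (N <= n)%N -> n.+1%:R^-1 < e.
  move=> e0; have [N _ hN] := near_infty_natSinv_lt (PosNum e0).
  by exists N => n Nn; exact: hN.
have cau (e : R) : 0 < e -> exists N, forall n, (N <= n)%N ->
    sqnorm (x_ N - x_ n) + sqnorm (B (x_ N) - B (x_ n)) < e.
  move=> e0; have [|N hN] := small (e / 4); first by rewrite divr_gt0.
  exists N => n Nn; have [BN JN] := x_P N; have [Bn Jn] := x_P n.
  have := para _ _ BN Bn.
  move: (hN _ (leqnn N)) (hN _ Nn) JN Jn; rewrite !ltr_pdivlMr //.
  move: (N.+1%:R^-1) (n.+1%:R^-1) (J _) (J _) => a b j j'; lra.
have [y xy] : exists y, x_ n @[n --> \oo] --> y.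
  apply: sqnorm_cauchy => e /cau[N hN]; exists N => n /hN.
  by have := sqnorm_ge0 (B (x_ N) - B (x_ n)); lra.
have [z Bxz] : exists z : H, B (x_ n) @[n --> \oo] --> z.
  apply: (@sqnorm_cauchy (fun n => B (x_ n))) => e /cau[N hN].
  exists N => n /hN; by have := sqnorm_ge0 (x_ N - x_ n); lra.
have [/= By zE] : [set p : H * H | dom B p.1 /\ p.2 = B p.1] (y, z).
  apply: (@closed_cvg _ _ (\oo) _ (fun n => (x_ n, B (x_ n))) _ cB); last first.
    exact: cvg_pair.
  by apply: nearW => n; split => //=; case: (x_P n).
exists y => // w Bw; apply/eqP; rewrite -subr_eq0 -sqrf_eq0 eq_le sqr_ge0 andbT.
apply/ler_addgt0Pl => e e0; rewrite addr0.
pose L x := rinner (u - x) w - rinner (B x) (B w).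
pose W := sqnorm w + sqnorm (B w) + 1.
have W1 : 1 <= W by rewrite lerDr addr_ge0 ?sqnorm_ge0.
have W0 : 0 < W by apply: lt_le_trans W1.
(* J (x_ n + t w) >= d at t = L (x_ n) / W, close to the minimiser in t. *)
have LJ n : L (x_ n) ^+ 2 <= n.+1%:R^-1 * W.
  have [Bx Jx] := x_P n; pose t := L (x_ n) / W.
  have [Bt Bte] := opZ t%:C Bw; have [Bs Bse] := opD Bx Bt.
  have := dJ _ Bs; rewrite /J Bse Bte opprD addrA sqnormB sqnormD !sqnormZ /=.
  rewrite !rinnerZr => hd.
  have tW : t ^+ 2 * W = t * L (x_ n).
    by rewrite expr2 -mulrA /t divfK ?gt_eqF.
  have : t * L (x_ n) <= n.+1%:R^-1.
    move: hd Jx tW (sqr_ge0 t); rewrite /J /W /L.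
    move: t (n.+1%:R^-1) {Bt Bte Bs Bse} => t v; lra.
  by rewrite /t -mulrA mulrC -mulrA -expr2 ler_pdivrMl // mulrC.
pose e' := e / (16 * W).
have e'0 : 0 < e' by rewrite divr_gt0 // mulr_gt0.
have e'W : 16 * (e' * W) = e by rewrite /e'; field; rewrite gt_eqF.
have [N hN] := small _ e'0.
near \oo => n.
have n1 : sqnorm (y - x_ n) < e' by near: n; exact: cvg_sqnorm.
have n2 : sqnorm (z - B (x_ n)) < e'.
  by near: n; exact: (@cvg_sqnorm (fun n => B (x_ n))).
have n3 : n.+1%:R^-1 < e' by apply: hN; near: n; exact: nbhs_infty_ge.
have := LJ n.
have -> : L (x_ n) = L y + (rinner (y - x_ n) w + rinner (z - B (x_ n)) (B w)).
  by rewrite /L zE !rinnerDl !rinnerNl; lra.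
move: (rinner_sqr_le (y - x_ n) w) (rinner_sqr_le (z - B (x_ n)) (B w)).
rewrite -[_ - rinner (B y) _]/(L y).
set l := L y; set a := rinner _ w; set b := rinner _ (B w) => ha hb hl.
have ha' : a ^+ 2 <= e' * W.
  apply: le_trans ha _; apply: ler_pM; rewrite ?sqnorm_ge0 ?ltW //.
  by rewrite /W; have := sqnorm_ge0 (B w); lra.
have hb' : b ^+ 2 <= e' * W.
  apply: le_trans hb _; apply: ler_pM; rewrite ?sqnorm_ge0 ?ltW //.
  by rewrite /W; have := sqnorm_ge0 w; lra.
have hl' : (l + (a + b)) ^+ 2 <= e' * W.
  by apply: le_trans hl _; rewrite ler_wpM2r ?ltW.
have h1 := sqr_ge0 (l + 2 * (a + b)); have h2 := sqr_ge0 (a - b).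
lra.
Unshelve. all: by end_near. Qed.

End GraphProjection.

(** * Cauchy estimates for polynomials *)

Section CauchyEstimate.
Variable F : numClosedFieldType.
Implicit Types (p : {poly F}) (r k s t : F).

(** The maximum principle at the centre of a disc.  The average of p at s and -s
    is the value at s ^+ 2 of the even part of p, which has half the degree and
    the same constant term. *)
Lemma coef0_le_circle p r k : 0 <= r ->
  (forall s, `|s| = r -> `|p.[s]| <= k) -> `|p`_0| <= k.
Proof.
have [m] := ubnP (size p); elim: m p r k => // m IHm p r k pm r0 pk.
have [p1|p1] := leqP (size p) 1.
  have := pk r (ger0_norm r0); rewrite [in X in X -> _](size1_polyC p1).
  by rewrite hornerC.
have -> : p`_0 = (even_poly p)`_0 by rewrite coef_even_poly.
apply: (IHm _ (r ^+ 2)); last 1 first.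
- move=> t tr; pose s := sqrtC t; have st : s ^+ 2 = t by rewrite sqrtCK.
  have sr : `|s| = r.
    apply/eqP; rewrite -(@eqrXn2 _ 2) ?normr_ge0 //.
    by rewrite -normrX st tr.
  have -> : (even_poly p).[t] = (p.[s] + p.[- s]) / 2.
    rewrite -[X in (X.[s] + X.[- s]) / 2](poly_even_odd p).
    rewrite !(hornerD, hornerM, hornerX, horner_comp, hornerXn).
    rewrite mulrNN -expr2 st.
    rewrite mulrN addrACA subrr addr0 -mulr2n.
    by rewrite -[_ *+ 2]mulr_natr mulfK // pnatr_eq0.
  rewrite normrM normfV [`|2|]ger0_norm // ler_pdivrMr // mulr_natr mulr2n.
  by apply: le_trans (ler_normD _ _) _; rewrite lerD // pk // normrN.
- apply: leq_ltn_trans (size_even_poly p) _.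
  by move: p1 pm; lia.
- by rewrite exprn_ge0.
Qed.

Lemma coef1_le_circle p r k : 0 < r ->
  (forall s, `|s| = r -> `|p.[s]| <= k) -> `|p`_1| * r <= 2 * k.
Proof.
move=> r0 pk; have p0k : `|p`_0| <= k by apply: coef0_le_circle pk; exact: ltW.
rewrite -ler_pdivlMr //; have -> : p`_1 = (drop_poly 1 p)`_0.
  by rewrite coef_drop_poly.
apply: (coef0_le_circle (ltW r0)) => s sr; rewrite ler_pdivlMr // -sr -normrM.
have -> : (drop_poly 1 p).[s] * s = p.[s] - p`_0.
  rewrite -[in X in _ = X.[s] - _](poly_take_drop 1 p) hornerD hornerM hornerXn.
  have /size1_polyC -> : (size (take_poly 1 p) <= 1)%N by exact: size_take_poly.
  rewrite hornerC coef_take_poly /=.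
  ring.
rewrite mulr_natl mulr2n.
by apply: le_trans (ler_normB _ _) _; rewrite lerD // pk.
Qed.

End CauchyEstimate.

(** * Commutation from power bounds *)

Section Iter.

Lemma iter_commute (T : Type) (f g : T -> T) : (forall x, f (g x) = g (f x)) ->
  forall n x, f (iter n g x) = iter n g (f x).
Proof. by move=> fg; elim=> //= n IHn x; rewrite fg IHn. Qed.

Lemma iter_comp_commute (T : Type) (f g : T -> T) :
  (forall x, f (g x) = g (f x)) ->
  forall n x, iter n f (iter n g x) = iter n (f \o g) x.
Proof.
move=> fg; elim=> //= n IHn x.
by rewrite -(iter_commute (fun z => esym (fg z))) IHn.
Qed.

Lemma iter_adjoint (T : Type) (V : Type) (b : T -> T -> V) (f g : T -> T) :
  (forall x y, b (f x) y = b x (g y)) ->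
  forall n x y, b (iter n f x) y = b x (iter n g y).
Proof. by move=> fg; elim=> // n IHn x y; rewrite iterSr IHn fg -iterS. Qed.

Lemma expr1D_le (R : realFieldType) (h : R) m :
  0 <= h -> (1 + h) ^+ m * (1 - m%:R * h) <= 1.
Proof.
move=> h0; elim: m => [|m IHm]; first by rewrite expr0 mul0r subr0 mulr1.
apply: le_trans IHm; rewrite exprSr -mulrA ler_wpM2l ?exprn_ge0 ?addr_ge0 //.
rewrite -natr1; have := mulr_ge0 (ler0n R m) (sqr_ge0 h); rewrite expr2; nra.
Qed.

End Iter.

Section Commutation.
Variables (R : realType) (H : hilbertType R).
Implicit Types (x y z : H) (a : R) (s t : R[i]).

Lemma rinnerZE s x y :
  rinner x (s *: y) =
  complex.Re s * rinner x y + complex.Im s * rinner x ('i%C *: y).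
Proof.
rewrite [in LHS](complexE s) mulrC scalerDl rinnerDr rinnerZr -scalerA.
by rewrite rinnerZr.
Qed.

Lemma inner_norm_le x y (k : R) : 0 <= k ->
  2 * (sqnorm x * sqnorm y) <= k ^+ 2 -> `|inner x y| <= k%:C.
Proof.
move=> k0 hk; rewrite normc_def lecR innerE /=.
rewrite !(mul0r, mul1r, mulr0, subr0, addr0, add0r).
rewrite -(ger0_norm k0) -sqrtr_sqr ler_wsqrtr //; apply: le_trans hk.
have := rinner_sqr_le x y; have := rinner_sqr_le x ('i%C *: y).
by rewrite sqnormZ /= expr0n expr1n /= add0r mul1r; lra.
Qed.

Lemma innerDZl s x y z : inner (x + s *: y) z = inner x z + s * inner y z.
Proof. by rewrite linearDl linearZl_LR. Qed.

Lemma innerDZr s x y z : inner z (x + s *: y) = inner z x + s^*%R * inner z y.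
Proof. by rewrite addrC inner_linr addrC. Qed.

Lemma linearDZ (L : {linear H -> H}) s x y : L (x + s *: y) = L x + s *: L y.
Proof. by rewrite linearD linearZ. Qed.

Variables (K C : {linear H -> H}).
Hypothesis Ksa : forall x y, rinner (K x) y = rinner x (K y).
Hypothesis Csa : forall x y, rinner (C x) y = rinner x (C y).

Lemma sym_inner (L : {linear H -> H}) :
  (forall x y, rinner (L x) y = rinner x (L y)) ->
  forall x y, inner (L x) y = inner x (L y).
Proof. by move=> Lsa x y; apply: inner_eqP; rewrite ?Lsa ?linearZ. Qed.

(** The operator 1 + sK. *)
Definition affop s x := x + s *: K x.

Lemma affopE s x : affop s x = x + s *: K x. Proof. by []. Qed.

Lemma affopK s x : K (affop s x) = affop s (K x).
Proof. exact: linearDZ. Qed.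

Lemma affopC s t x : affop s (affop t x) = affop t (affop s x).
Proof.
rewrite /affop !(linearDZ K) !scalerDr !scalerA (mulrC s).
by rewrite -!addrA; congr (_ + _); rewrite addrCA.
Qed.

Lemma affop_inner s x y : inner (affop s x) y = inner x (affop s^*%R y).
Proof.
rewrite !affopE innerDZr conjCK innerDZl; congr (_ + _ * _).
exact: sym_inner.
Qed.

Lemma affop_rinner a x y : rinner (affop a%:C x) y = rinner x (affop a%:C y).
Proof. by rewrite rinnerDl rinnerDr rinnerZl rinnerZr Ksa. Qed.

(** K is symmetric, so that <K x, x> is real. *)
Lemma rinner_iK x : rinner x ('i%C *: K x) = 0.
Proof.
have : rinner x ('i%C *: K x) = - rinner x ('i%C *: K x).
  by rewrite -rinneriZ -linearZ -Ksa rinnerC.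
lra.
Qed.

Lemma sqnorm_affop s x :
  sqnorm (affop s x) = sqnorm x + 2 * complex.Re s * rinner (K x) x
    + (complex.Re s ^+ 2 + complex.Im s ^+ 2) * sqnorm (K x).
Proof.
by rewrite sqnormD sqnormZ rinnerZE rinner_iK mulr0 addr0 mulrA (rinnerC x).
Qed.

Hypothesis Kpos : forall x, 0 <= rinner (K x) x.
Hypothesis Kle : forall x, sqnorm (K x) <= sqnorm x.

(** For K between 0 and 1 and Re t >= 0, replacing t by its real part decreases
    the norm of (1 + tK)x by a factor close to 1 at most. *)
Lemma sqnorm_affop_le (d : R) t x : 0 <= complex.Re t -> 0 <= d ->
  complex.Re t ^+ 2 + complex.Im t ^+ 2 <= d ->
  sqnorm (affop t x) <= (1 + d) * sqnorm (affop (complex.Re t)%:C x).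
Proof.
move=> t0 d0 td; rewrite !sqnorm_affop /=.
have := Kpos x; have := Kle x; have := sqnorm_ge0 (K x).
move: td t0; move: (complex.Re t) (complex.Im t) => a b td a0 k0 kx p0.
have q0 : 0 <= sqnorm x by lra.
have h1 : 0 <= d * (2 * a * rinner (K x) x + a ^+ 2 * sqnorm (K x)).
  by rewrite mulr_ge0 // addr_ge0 ?mulr_ge0 // ?sqr_ge0.
have h2 : b ^+ 2 * sqnorm (K x) <= d * sqnorm x.
  by apply: ler_pM; rewrite ?sqr_ge0 //; have := sqr_ge0 a; lra.
rewrite expr0n /=; lra.
Qed.

(** With a = Re t, the product (1 + aK)(1 - tK) is a contraction up to second
    order in t: for real t it is 1 - a^2 K^2. *)
Lemma sqnorm_affopM_le (d : R) t x : 0 <= complex.Re t -> d <= 1 ->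
  complex.Re t ^+ 2 + complex.Im t ^+ 2 <= d ->
  sqnorm (affop (complex.Re t)%:C (affop (- t) x)) <= (1 + 4 * d) * sqnorm x.
Proof.
rewrite affopC; case: t => a b /= a0 d1 td.
set y := affop a%:C x.
have a1 : a <= 1 by have := sqr_ge0 b; nra.
have hy : sqnorm y <= 4 * sqnorm x.
  rewrite sqnorm_affop /= expr0n /= addr0.
  have := Kpos x; have := Kle x; have := sqnorm_ge0 (K x).
  have := sqnorm_ge0 (x - K x); rewrite sqnormB (rinnerC x).
  set p := rinner _ x; set q := sqnorm x; set k := sqnorm _ => h k0 kq p0.
  have pq : a * p <= 1 * q by apply: ler_pM => //; lra.
  have : a ^+ 2 * k <= 1 * q by apply: ler_pM; rewrite ?sqr_ge0 ?expr_le1.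
  lra.
have -> : sqnorm (affop (- (a +i* b)) y) =
    sqnorm (affop (- a)%:C y) + b ^+ 2 * sqnorm (K y).
  by rewrite !sqnorm_affop /= !sqrrN expr0n /=; ring.
have hz : sqnorm (affop (- a)%:C y) <= sqnorm x.
  have -> : affop (- a)%:C y = x - (a ^+ 2)%:C *: K (K x).
    rewrite /y /affop [K (x + _)]linearD [K (_ *: _)]linearZ /=.
    rewrite rmorphN rmorphXn /= scaleNr scalerDr opprD scalerA -expr2.
    by rewrite addrA addrK.
  rewrite sqnormB sqnormZ rinnerZr /= expr0n /= addr0 -Ksa -/(sqnorm _).
  have := Kle (K x); have := sqnorm_ge0 (K (K x)).
  set k := sqnorm (K x); set k2 := sqnorm _ => k20 k2k.
  have a20 := sqr_ge0 a; have a21 : a ^+ 2 <= 1 by rewrite expr_le1.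
  have h1 : a ^+ 2 * k2 <= 1 * k2 by apply: ler_wpM2r.
  have : a ^+ 2 * (a ^+ 2 * k2) <= a ^+ 2 * k by apply: ler_wpM2l => //; lra.
  have : 0 <= a ^+ 2 * k by rewrite mulr_ge0 //; lra.
  by rewrite -mulrA mulrA -expr2; lra.
have : b ^+ 2 * sqnorm (K y) <= d * (4 * sqnorm x).
  apply: ler_pM; rewrite ?sqr_ge0 ?sqnorm_ge0 //.
    by have := sqr_ge0 a; lra.
  exact: le_trans (Kle y) hy.
lra.
Qed.

Lemma sqnorm_iter_le (c : R) (f : H -> H) (g : H -> H) : 0 <= c ->
  (forall x, sqnorm (f x) <= c * sqnorm (g x)) ->
  (forall x, f (g x) = g (f x)) ->
  forall n x, sqnorm (iter n f x) <= c ^+ n * sqnorm (iter n g x).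
Proof.
move=> c0 fg fgC; elim=> [|n IHn] x; first by rewrite expr0 mul1r.
rewrite iterSr; apply: le_trans (IHn _) _.
rewrite exprSr -mulrA ler_wpM2l ?exprn_ge0 //.
by rewrite -(iter_commute fgC) iterS.
Qed.

Variable M : R.
Hypothesis M0 : 0 <= M.
Hypothesis CM : forall m z,
  rinner (iter m K (C z)) (C z) <= M * rinner (iter m K z) z.

(** The powers of 1 + aK, a >= 0, are combinations of powers of K with
    nonnegative coefficients, so the bound CM passes to them. *)
Lemma affop_pow_le a k j z : 0 <= a ->
  rinner (iter k (affop a%:C) (iter j K (C z))) (C z) <=
  M * rinner (iter k (affop a%:C) (iter j K z)) z.
Proof.
move=> a0; elim: k j => [|k IHk] j; first exact: CM.
rewrite !iterS affopE !rinnerDl !rinnerZl.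
rewrite !(iter_commute (affopK a%:C)) -!iterS mulrDr lerD //.
by rewrite mulrCA ler_wpM2l.
Qed.

Lemma sqnorm_iter_affop_le a n z : 0 <= a ->
  sqnorm (iter n (affop a%:C) (C z)) <= M * sqnorm (iter n (affop a%:C) z).
Proof.
move=> a0; have := affop_pow_le (n + n) 0 z a0.
have E u : rinner (iter (n + n) (affop a%:C) u) u =
    sqnorm (iter n (affop a%:C) u).
  by rewrite iterD (iter_adjoint (affop_rinner a)).
by rewrite /= !E.
Qed.

(** The operator (1 + sK)^n C (1 - sK)^n, a substitute
    for e^(nsK) C e^(-nsK). *)
Definition conjugated n s x := iter n (affop s) (C (iter n (affop (- s)) x)).

Lemma sqnorm_conjugated_le (d : R) n s x : 0 <= complex.Re s -> d <= 1 ->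
  complex.Re s ^+ 2 + complex.Im s ^+ 2 <= d -> 8 * d * n%:R <= 2^-1 ->
  sqnorm (conjugated n s x) <= 2 * (M * sqnorm x).
Proof.
move=> s0 d1 sd dn; have d0 : 0 <= d.
  by apply: le_trans sd; rewrite addr_ge0 ?sqr_ge0.
have Mx : 0 <= M * sqnorm x by rewrite mulr_ge0 ?sqnorm_ge0.
set y := iter n (affop (- s)) x.
have h1 : sqnorm (conjugated n s x) <=
    (1 + d) ^+ n * sqnorm (iter n (affop (complex.Re s)%:C) (C y)).
  apply: sqnorm_iter_le => [|z|z]; first by rewrite addr_ge0.
    exact: sqnorm_affop_le.
  exact: affopC.
have h2 := sqnorm_iter_affop_le n y s0.
have h3 : sqnorm (iter n (affop (complex.Re s)%:C) y) <=
    (1 + 4 * d) ^+ n * sqnorm x.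
  have -> : iter n (affop (complex.Re s)%:C) y =
      iter n (affop (complex.Re s)%:C \o affop (- s)) x.
    exact: (iter_comp_commute (affopC _ _)).
  have -> : sqnorm x = sqnorm (iter n id x).
    by congr sqnorm; elim: n {dn y h1 h2}.
  apply: sqnorm_iter_le => // [|z]; first by rewrite addr_ge0 ?mulr_ge0.
  exact: sqnorm_affopM_le.
have h4 : (1 + d) ^+ n <= (1 + 4 * d) ^+ n.
  by apply: lerXn2r; rewrite ?nnegrE; lra.
have p0 : 0 <= (1 + 4 * d) ^+ n by rewrite exprn_ge0 //; lra.
have h5 : (1 + 4 * d) ^+ n * (1 + 4 * d) ^+ n <= 2.
  have := @expr1D_le R (4 * d) (n + n) _; rewrite exprD natrD.
  rewrite mulr_ge0 // => /(_ isT).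
  move: (_ * _ ^+ n) (mulr_ge0 p0 p0) => c; nra.
apply: le_trans h1 _.
have h6 : M * sqnorm (iter n (affop (complex.Re s)%:C) y) <=
    (1 + 4 * d) ^+ n * (M * sqnorm x) by rewrite mulrCA ler_wpM2l.
have h7 := le_trans h2 h6.
apply: (@le_trans _ _ ((1 + 4 * d) ^+ n * ((1 + 4 * d) ^+ n * (M * sqnorm x)))).
  by apply: ler_pM; rewrite ?sqnorm_ge0 // exprn_ge0 // addr_ge0.
by rewrite mulrA ler_wpM2r.
Qed.

(** The adjoint exchanges the half-planes Re s >= 0 and Re s <= 0. *)
Lemma conjugated_adjoint n s x y :
  inner (conjugated n s x) y = inner x (conjugated n (- s^*%R) y).
Proof.
rewrite /conjugated !(iter_adjoint (affop_inner _)) (sym_inner Csa).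
by rewrite !(iter_adjoint (affop_inner _)) opprK rmorphN.
Qed.

Lemma inner_conjugated_le (d : R) n s x y : d <= 1 ->
  complex.Re s ^+ 2 + complex.Im s ^+ 2 <= d -> 8 * d * n%:R <= 2^-1 ->
  `|inner (conjugated n s x) y| <=
  (Num.sqrt (4 * (M * (sqnorm x * sqnorm y))))%:C.
Proof.
move=> d1 sd dn.
have xy0 : 0 <= 4 * (M * (sqnorm x * sqnorm y)).
  by rewrite !mulr_ge0 ?sqnorm_ge0.
have [s0|s0] := leP 0 (complex.Re s).
  apply: inner_norm_le; rewrite ?sqrtr_ge0 // sqr_sqrtr //.
  have := sqnorm_conjugated_le x s0 d1 sd dn.
  by move=> /(ler_wpM2r (sqnorm_ge0 y)); lra.
rewrite conjugated_adjoint; apply: inner_norm_le; rewrite ?sqrtr_ge0 //.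
rewrite sqr_sqrtr //.
have := @sqnorm_conjugated_le d n (- s^*%R) y.
case: s sd s0 => a b /= sd s0; rewrite opprK sqrrN oppr_ge0 (ltW s0).
move=> /(_ isT d1 sd dn) /(ler_wpM2l (sqnorm_ge0 x)); lra.
Qed.

(** Matrix coefficients of (1 + esK)^k C (1 - esK)^l are polynomials in s; their
    linear term is the commutator of K and C when k = l = 1/e. *)
Lemma conjugated_poly (e : R) k l x y : exists p : {poly R[i]},
  [/\ forall s, p.[s] = inner (C (iter l (affop (- (e%:C * s))) x))
                              (iter k (affop (e%:C * s)^*%R) y),
      p`_0 = inner (C x) y &
      p`_1 = e%:C * (k%:R * inner (C x) (K y) - l%:R * inner (C (K x)) y)].
Proof.
elim: k l x y => [|k IHk] l x y.
  elim: l x => [|l IHl] x.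
    exists (inner (C x) y)%:P; split=> [s||]; first by rewrite hornerC.
      by rewrite coefC.
    by rewrite coefC /= !mul0r subrr mulr0.
  have [p [pE p0 p1]] := IHl x; have [r [rE r0 r1]] := IHl (K x).
  exists (p - e%:C *: (r * 'X)); split => [s||].
  - rewrite hornerD hornerN hornerZ hornerMX pE rE iterS affopE.
    rewrite (iter_commute (affopK _)) linearDZ innerDZl.
    by ring.
  - by rewrite coefB coefZ coefMX /= mulr0 subr0.
  - rewrite coefB coefZ coefMX /= p1 r0 -natr1; ring.
have [p [pE p0 p1]] := IHk l x y; have [r [rE r0 r1]] := IHk l x (K y).
exists (p + e%:C *: (r * 'X)); split => [s||].
- rewrite hornerD hornerZ hornerMX pE rE iterS affopE.
  rewrite (iter_commute (affopK _)) innerDZr conjCK.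
  by ring.
- by rewrite coefD coefZ coefMX /= mulr0 addr0.
- rewrite coefD coefZ coefMX /= p1 r0 -natr1; ring.
Qed.

(** A Liouville argument: the polynomials given by [conjugated_poly] for
    e = 1/n are bounded on the circle of radius N independently of N. *)
Lemma commute_of_pow_le x : K (C x) = C (K x).
Proof.
apply/eqP; rewrite -subr_eq0; apply/eqP/rinner_eq0 => y.
suff : inner (C x) (K y) - inner (C (K x)) y = 0.
  move=> /(congr1 (@complex.Re R)); rewrite raddfB /= => h.
  by rewrite rinnerDl rinnerNl Ksa.
pose c := Num.sqrt (4 * (M * (sqnorm x * sqnorm y))).
set D := _ - _.
have bnd (N : nat) : (0 < N)%N -> `|D| * N%:R <= 2 * c%:C.
  move=> N0; pose n := (16 * N ^ 2)%N.
  (* Then 8 d n = 1/2 for d = (N / n)^2, the squared modulus of s / n. *)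
  have N0' : (0 : R) < N%:R by rewrite ltr0n.
  have n0 : (0 : R) < n%:R by rewrite ltr0n muln_gt0 expn_gt0 N0.
  have nE : n%:R = 16 * N%:R ^+ 2 :> R by rewrite natrM natrX.
  have [p [pE _ p1]] := conjugated_poly n%:R^-1 n n x y.
  have -> : D = p`_1.
    rewrite p1 -mulrBr mulrA fmorphV /= rmorph_nat mulVf ?mul1r //.
    by rewrite pnatr_eq0 -lt0n -(ltr0n R).
  apply: coef1_le_circle; first by rewrite ltr0n.
  move=> s sN; rewrite pE -(iter_adjoint (affop_inner _)).
  pose d : R := N%:R ^+ 2 / n%:R ^+ 2.
  apply: (@inner_conjugated_le d).
  - rewrite /d ler_pdivrMr ?exprn_gt0 // mul1r ler_pXn2r ?nnegrE ?ler0n //.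
    rewrite ler_nat /n; nia.
  - rewrite le_eqVlt; apply/orP; left; apply/eqP/complexI.
    rewrite add_Re2_Im2 normrM exprMn sN /d.
    rewrite ger0_norm ?lecR ?invr_ge0 ?ler0n //.
    rewrite [RHS]rmorphM /= rmorphXn rmorph_nat -exprVn mulrC.
    by congr (_ * _); rewrite [RHS]rmorphXn.
  - rewrite /d nE le_eqVlt; apply/orP; left; apply/eqP; field.
    by rewrite gt_eqF.
apply/eqP; rewrite -normr_eq0; apply/eqP.
have [r r0 rE] : exists2 r : R, 0 <= r & `|D| = r%:C.
  by exists (Num.sqrt (complex.Re D ^+ 2 + complex.Im D ^+ 2));
    rewrite ?sqrtr_ge0 // normc_def.
rewrite rE; have [->//|rn0] := eqVneq r 0.
have rp : 0 < r by rewrite lt_def rn0.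
have c0 : 0 <= 2 * c / r by rewrite divr_ge0 ?mulr_ge0 ?sqrtr_ge0.
have := archi_boundP c0; set N := Num.bound _ => hN.
have N0 : (0 < N)%N by rewrite -(ltr0n R); apply: le_lt_trans hN.
have := bnd _ N0; rewrite rE -(rmorph_nat (real_complex R) N).
rewrite -(rmorph_nat (real_complex R) 2) -!rmorphM lecR.
rewrite ltr_pdivrMr // [N%:R * r]mulrC in hN.
by move=> /(lt_le_trans hN); rewrite ltxx.
Qed.

End Commutation.

(** * Adjoint pairs and resolvents *)

Section Resolvent.
Variables (R : realType) (H : hilbertType R).
Implicit Types (S : operator H) (K : H -> H) (u x y z : H).

(** S and S' are adjoint to each other on their domains, neither being required
    to be maximal. *)
Definition formal_adjoint (S S' : operator H) :=
  forall x y, dom S x -> dom S' y -> inner (S x) y = inner x (S' y).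

(** K is a right inverse of 1 + S'S; when S and S' are adjoint to each other,
    1 + S'S is injective by [resolvent_uniq] and K is its inverse. *)
Definition resolvent (S S' : operator H) K := forall u,
  [/\ dom S (K u), dom S' (S (K u)) & K u + S' (S (K u)) = u].

Lemma formal_adjoint_sym S S' : formal_adjoint S S' -> formal_adjoint S' S.
Proof. by move=> SS' x y Sx Sy; rewrite inner_conj -SS' // -inner_conj. Qed.

Lemma adjoint_formal S (dS : densely_defined S) : formal_adjoint S (adjoint dS).
Proof. by move=> x y Sx Sy; exact: adj_appP. Qed.

(** The adjoint is the largest formal adjoint. *)
Lemma adj_relE S (dS : densely_defined S) y z : adj_rel S y z ->
  dom (adjoint dS) y /\ adjoint dS y = z.
Proof.
move=> yz; have Sy : adj_dom S y by exists z.
split=> //; apply: (dense_inner_inj dS) => x Sx.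
by rewrite -(adj_appP Sy) // yz.
Qed.

Lemma formal_adjoint_rinner S S' x y : formal_adjoint S S' ->
  dom S x -> dom S' y -> rinner (S x) y = rinner x (S' y).
Proof. by move=> SS' Sx Sy; rewrite /rinner SS'. Qed.

Lemma resolvent_uniq S S' y y' : formal_adjoint S S' ->
  dom S y -> dom S' (S y) -> dom S y' -> dom S' (S y') ->
  y + S' (S y) = y' + S' (S y') -> y = y'.
Proof.
move=> SS' Sy S'y Sy' S'y' e; apply/eqP; rewrite -subr_eq0; apply/eqP.
have [Sz zE] := opB Sy Sy'; have [S'z S'zE] := opB S'y S'y'.
apply: sqnorm_eq0; set z := y - y' in Sz zE *.
have : z + S' (S z) = 0.
  by rewrite zE S'zE /z addrACA -opprD e subrr.
move=> /(congr1 (rinner z)); rewrite rinner0r rinnerDr.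
rewrite -(formal_adjoint_rinner SS') //; last by rewrite zE.
move=> h; have := sqnorm_ge0 z; have := sqnorm_ge0 (S z).
by move: h; rewrite /sqnorm; lra.
Qed.

Lemma resolvent_exists S (dS : densely_defined S) : closed_op S ->
  exists K : {linear H -> H}, resolvent S (adjoint dS) K.
Proof.
move=> cS.
have /choice[K KP] u : exists y, [/\ dom S y, dom (adjoint dS) (S y) &
    y + adjoint dS (S y) = u].
  have [y Sy yP] := closed_graph_projection cS u.
  have /(adj_relE dS)[S'y yE] : adj_rel S (S y) (u - y).
    move=> w Sw; have [Siw iwE] := opZ 'i%C Sw.
    rewrite inner_conj [RHS]inner_conj; congr (_^*)%R.
    by apply: inner_eqP; rewrite -?iwE -?yP.
  by exists y; split=> //; rewrite yE addrC subrK.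
suff linK : linear K.
  pose KL : {linear H -> H} := HB.pack K (GRing.isLinear.Build _ _ _ _ K linK).
  by exists KL.
move=> a x y; have [Sx S'x xE] := KP x; have [Sy S'y yE] := KP y.
have [Sa S'a aE] := KP (a *: x + y).
have S'axy : dom (adjoint dS) (S (a *: K x + K y)).
  by rewrite app_lin //; exact: dom_lin.
refine (resolvent_uniq (@adjoint_formal _ dS) Sa S'a (dom_lin a Sx Sy) S'axy _).
rewrite aE app_lin // app_lin // -{1}xE -{1}yE scalerDr.
by rewrite addrACA.
Qed.

Section Properties.
Variables (S S' : operator H) (K : {linear H -> H}).
Hypotheses (SS' : formal_adjoint S S') (resK : resolvent S S' K).

Lemma resolvent_rinner x y :
  rinner x (K y) = rinner (K x) (K y) + rinner (S (K x)) (S (K y)).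
Proof.
have [Sx S'x xE] := resK x; have [Sy S'y yE] := resK y.
rewrite -{1}xE rinnerDl; congr (_ + _).
by rewrite rinnerC -(formal_adjoint_rinner SS') // rinnerC.
Qed.

Lemma resolvent_sym x y : rinner (K x) y = rinner x (K y).
Proof.
rewrite rinnerC [LHS]resolvent_rinner [RHS]resolvent_rinner.
by rewrite (rinnerC (K x)) (rinnerC (S (K x))).
Qed.

Lemma resolvent_ge0 x : 0 <= rinner (K x) x.
Proof. by rewrite rinnerC resolvent_rinner addr_ge0 ?sqnorm_ge0. Qed.

Lemma resolvent_eq0 x : rinner (K x) x = 0 -> x = 0.
Proof.
rewrite rinnerC resolvent_rinner => h; have [_ _ <-] := resK x.
move: (sqnorm_ge0 (K x)) (sqnorm_ge0 (S (K x))); rewrite /sqnorm => h1 h2.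
by rewrite (@sqnorm_eq0 _ _ (K x)) ?app0 ?addr0 //; rewrite /sqnorm; lra.
Qed.

Lemma resolvent_sqnorm_le x : sqnorm (K x) <= sqnorm x.
Proof.
have := sqnorm_ge0 (x - K x); rewrite sqnormB resolvent_rinner.
by have := sqnorm_ge0 (S (K x)); rewrite /sqnorm; lra.
Qed.

(** When SS' = S'S, the operator S commutes with (1 + S'S)^-1. *)
Lemma resolvent_commute x : op_eq (op_comp S S') (op_comp S' S) ->
  dom S x -> K (S x) = S (K x).
Proof.
move=> [SSd SSe] Sx; have [Sk S'k kE] := resK x.
have [Sd dE] := opB Sx Sk.
have kE' : S' (S (K x)) = x - K x by rewrite -{2}kE addrC addKr.
have Sk2 : dom (op_comp S S') (S (K x)) by split=> //; rewrite kE'.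
have := Sk2; rewrite SSd => -[SSk S'SSk].
have [S1 S2 e] := resK (S x).
apply: (resolvent_uniq SS') => //; rewrite e.
have /= <- := SSe _ Sk2.
by rewrite kE' dE addrC subrK.
Qed.

Hypothesis KS : forall x, dom S x -> K (S x) = S (K x).

(** The domain of S^m, in the form suited to [pow_form]. *)
Fixpoint pow_dom S m x : Prop :=
  if m is n.+1 then [/\ dom S x, pow_dom S n x & pow_dom S n (S x)] else True.

(** The sum over k of binomial(m, k) |S^k x|^2, which for normal S is
    <(1 + S'S)^m x, x>. *)
Fixpoint pow_form S m x : R :=
  if m is n.+1 then pow_form S n x + pow_form S n (S x) else sqnorm x.

Lemma pow_form_ge0 S0 m x : 0 <= pow_form S0 m x.
Proof. by elim: m x => [|m IHm] x /=; rewrite ?sqnorm_ge0 ?addr_ge0. Qed.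

Lemma resolvent_iter m x : dom S x ->
  dom S (iter m K x) /\ iter m K (S x) = S (iter m K x).
Proof.
move=> Sx; elim: m => //= m [Sm mE]; have [Sk _ _] := resK (iter m K x).
by rewrite mE KS.
Qed.

(** The form <(1 + S'S)^(-m) x, x>, dual to [pow_form] by [rinner_pow_le]. *)
Definition res_form m x := rinner (iter m K x) x.

Lemma res_formS m y : res_form m.+1 y = res_form m (K y) + res_form m (S (K y)).
Proof.
have [Sy S'y yE] := resK y; have [Sm mE] := resolvent_iter m Sy.
rewrite -iterSr in Sm mE.
rewrite /res_form mE -iterSr (formal_adjoint_rinner SS') //.
by rewrite -rinnerDr yE.
Qed.

Lemma res_form_ge0 m y : 0 <= res_form m y.
Proof.
by elim: m y => [|m IHm] y; rewrite ?res_formS ?addr_ge0 //; exact: sqnorm_ge0.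
Qed.

Lemma pow_form_iter m u :
  pow_dom S m (iter m K u) /\ pow_form S m (iter m K u) = res_form m u.
Proof.
elim: m u => // m IHm u; rewrite iterSr; have [Su _ _] := resK u.
have [Sm mE] := resolvent_iter m Su.
have [d1 e1] := IHm (K u); have [d2 e2] := IHm (S (K u)).
by rewrite res_formS /= -mE -e1 -e2; split.
Qed.

(** The Cauchy-Schwarz inequality for [pow_form] at v and (1 + S'S)^(-m) y. *)
Lemma rinner_pow_le m v y : pow_dom S m v ->
  rinner v y ^+ 2 <= pow_form S m v * res_form m y.
Proof.
elim: m v y => [|m IHm] v y; first by move=> _; exact: rinner_sqr_le.
move=> /= [Sv dv dSv]; have [Sy S'y yE] := resK y.
have -> : rinner v y = rinner v (K y) + rinner (S v) (S (K y)).
  by rewrite -{1}yE rinnerDr (formal_adjoint_rinner SS').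
rewrite res_formS; move: (IHm _ (K y) dv) (IHm _ (S (K y)) dSv).
move: (pow_form_ge0 S m v) (pow_form_ge0 S m (S v)).
move: (res_form_ge0 m (K y)) (res_form_ge0 m (S (K y))).
move: (rinner v _) (rinner (S v) _) (pow_form S m v) (pow_form S m (S v)).
move: (res_form m (K y)) (res_form m (S (K y))).
move=> p1 p2 a b h1 h2 p10 p20 h10 h20 ha hb.
(* |ab| is at most the geometric mean of h1 p2 and h2 p1. *)
have hab : `|a * b| <= (h1 * p2 + h2 * p1) / 2.
  rewrite -(@ler_pXn2r _ 2) ?nnegrE ?normr_ge0 //; last first.
    by rewrite divr_ge0 ?addr_ge0 ?mulr_ge0.
  rewrite real_normK ?num_real // exprMn.
  have h : a ^+ 2 * b ^+ 2 <= h1 * p1 * (h2 * p2).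
    by apply: ler_pM; rewrite ?sqr_ge0.
  apply: le_trans h _; have := sqr_ge0 (h1 * p2 - h2 * p1); lra.
have := ler_norm (a * b); lra.
Qed.

End Properties.

Lemma intertwine_pow S S' (C : H -> H) (M : R) : 0 <= M ->
  (forall x, sqnorm (C x) <= M * sqnorm x) ->
  (forall x, dom S' x -> dom S (C x) /\ S (C x) = C (S' x)) ->
  forall m x, pow_dom S' m x ->
  pow_dom S m (C x) /\ pow_form S m (C x) <= M * pow_form S' m x.
Proof.
move=> M0 CM CS; elim=> [|m IHm] x //= [S'x dx dS'x].
have [SCx SCE] := CS _ S'x.
have [d1 e1] := IHm _ dx; have [d2 e2] := IHm _ dS'x.
by rewrite SCE mulrDr lerD.
Qed.

(** * A Fuglede theorem for an unbounded normal operator *)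

Section Fuglede.
Variables (B B' : operator H) (K C : {linear H -> H}) (M : R).
Hypotheses (BB' : formal_adjoint B B') (resK : resolvent B B' K).
Hypothesis B_normal : op_eq (op_comp B B') (op_comp B' B).
Hypotheses (M0 : 0 <= M) (CM : forall x, sqnorm (C x) <= M * sqnorm x).
Hypothesis Csa : forall x y, rinner (C x) y = rinner x (C y).
Hypothesis CB : forall x, dom B' x -> dom B (C x) /\ B (C x) = C (B' x).

Let B'B : formal_adjoint B' B := formal_adjoint_sym BB'.

Let B'_normal : op_eq (op_comp B' B) (op_comp B B').
Proof.
by case: B_normal => d e; split=> [//|x]; rewrite -d => /e.
Qed.

Lemma normal_resolvent : resolvent B' B K.
Proof.
move=> u; have [Bu B'u uE] := resK u; have [_ e] := B'_normal.
have d : dom (op_comp B' B) (K u) by [].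
have := d; rewrite -(proj1 B_normal) => -[B'k BB'k].
by split=> //; rewrite -[B _](e _ d).
Qed.

(** Duality between [pow_form] and [res_form]: test C z against v = C K^m C z,
    for which <v, z> = <K^m C z, C z>. *)
Lemma normal_res_form_le m z : res_form K m (C z) <= M * res_form K m z.
Proof.
have KB x : dom B x -> K (B x) = B (K x).
  exact: (resolvent_commute BB' resK).
have KB' x : dom B' x -> K (B' x) = B' (K x).
  exact: (resolvent_commute B'B normal_resolvent).
have [d1 e1] := pow_form_iter B'B normal_resolvent KB' m (C z).
have [d2 e2] := intertwine_pow M0 CM CB d1.
have := rinner_pow_le BB' resK KB z d2; rewrite Csa -/(res_form K m (C z)).
have p0 := res_form_ge0 BB' resK KB m (C z).
have q0 := res_form_ge0 BB' resK KB m z.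
move: e2; rewrite e1; move: (res_form _ _ (C z)) p0 (res_form _ _ _) q0.
move=> p p0 q q0 hp h; have [->|pn0] := eqVneq p 0; first by rewrite mulr_ge0.
rewrite -(@ler_pM2l _ p) ?lt_def ?pn0 // -expr2; apply: le_trans h _.
by rewrite [X in _ <= X]mulrA [p * M]mulrC ler_wpM2r.
Qed.

(** C commutes with (1 + B'B)^-1. *)
Lemma resolvent_intertwine x : K (C x) = C (K x).
Proof.
apply: (@commute_of_pow_le _ _ K C _ Csa _ _ M M0).
- exact: resolvent_sym BB' resK.
- exact: resolvent_ge0 BB' resK.
- exact: resolvent_sqnorm_le BB' resK.
- exact: normal_res_form_le.
Qed.

(** A normal operator and its adjoint have the same kernel (one inclusion). *)
Lemma normal_ker w : dom B w -> B w = 0 -> dom B' w /\ B' w = 0.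
Proof.
move=> Bw Bw0; have d : dom (op_comp B' B) w.
  by split=> //; rewrite Bw0; exact: dom0.
have := d; rewrite -(proj1 B_normal) => -[B'w BB'w]; split=> //.
apply: sqnorm_eq0; rewrite /sqnorm (formal_adjoint_rinner B'B) //.
by have /= <- := proj2 B'_normal _ d; rewrite Bw0 app0 rinner0r.
Qed.

(** CB <= B'C on the domain of B'B, which is the range of K. *)
Lemma fuglede_resolvent u : dom B' (C (K u)) /\ B' (C (K u)) = C (B (K u)).
Proof.
have [Bx B'x xE] := resK u; rewrite -resolvent_intertwine.
have [B'y By yE] := normal_resolvent (C u); split=> //.
have [BCx BCE] := CB B'x.
have [Bw wE] := opB By BCx; have [+ _] := opB By BCx.
set w := B' _ - _ in Bw wE *.
(* Both B B' C x and B C B x are C u - C x, where x = K u. *)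
have Bw0 : B w = 0.
  rewrite wE BCE; have -> : B' (B (K u)) = u - K u 
    by rewrite -[X in _ = X - _]xE addrC addKr.
  rewrite linearB /= -resolvent_intertwine -[X in _ - (X - _)]yE.
  by rewrite [X in _ - X]addrC addKr subrr.
move=> _; apply/eqP; rewrite -subr_eq0 -/w; apply/eqP.
(* C preserves the common kernel of B and B', so w is orthogonal to itself. *)
have [B'w B'w0] := normal_ker Bw Bw0.
have [BCw BCw0] := CB B'w; rewrite B'w0 linear0 in BCw0.
have [B'Cw B'Cw0] := normal_ker BCw BCw0.
apply: sqnorm_eq0; rewrite /sqnorm {1}/w rinnerDl rinnerNl Csa.
rewrite (formal_adjoint_rinner B'B) // Bw0 (formal_adjoint_rinner BB') // B'Cw0.
by rewrite !rinner0r subrr.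
Qed.

(** The operator C^-1 B has no eigenvalue -i. *)
Lemma intertwine_eigen z : dom B z -> B z = - ('i%C *: C z) -> C z = 0.
Proof.
move=> Bz zE; apply: (resolvent_eq0 BB' resK).
have [d e] := fuglede_resolvent z.
have : rinner (B z) ('i%C *: C (K z)) = rinner (C z) ('i%C *: B (K z)).
  have [d' e'] := opZ 'i%C d.
  by rewrite (formal_adjoint_rinner BB') // e' e Csa linearZ.
rewrite -(resolvent_commute BB' resK B_normal Bz) zE -resolvent_intertwine.
rewrite rinnerNl rinneriZ opprK linearN [K (_ *: _)]linearZ /= scalerN !scalerA.
by rewrite -expr2 sqr_i !scaleN1r opprK rinnerNr rinnerC; lra.
Qed.

End Fuglede.
End Resolvent.

(** * Self-adjoint operators *)

Section SelfAdjoint.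
Variables (R : realType) (H : hilbertType R).
Implicit Types (T : operator H).

Lemma self_adjoint_formal T : self_adjoint T -> formal_adjoint T T.
Proof.
move=> [dT [Td Te]] x y Tx Ty; rewrite (Te y) //; apply: adjoint_formal => //.
by rewrite -Td.
Qed.

Lemma self_adjoint_adj_rel T y z : self_adjoint T -> adj_rel T y z ->
  dom T y /\ T y = z.
Proof.
move=> [dT [Td Te]] /(adj_relE dT)[d e]; rewrite Td Te //; first by rewrite Td.
Qed.

Lemma self_adjoint_closed T : self_adjoint T -> closed_op T.
Proof.
move=> saT [y z] cl /=; have TT := self_adjoint_formal saT.
suff yz : adj_rel T y z by have [? ->] := self_adjoint_adj_rel saT yz.
suff yz x : dom T x -> rinner (T x) y = rinner x z.
  move=> x Tx; have [Tix ixE] := opZ 'i%C Tx.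
  apply: inner_eqP; first exact: yz.
  by apply: oppr_inj; rewrite -!rinneriZ -ixE yz.
move=> Tx; apply/eqP; rewrite -subr_eq0 -sqrf_eq0 eq_le sqr_ge0 andbT.
apply/ler_addgt0Pl => e e0; rewrite addr0.
pose W := sqnorm (T x) + sqnorm x + 1.
have W0 : 0 < W by rewrite ltr_wpDl // addr_ge0 ?sqnorm_ge0.
pose r := Num.sqrt (e / (4 * W)).
have eW0 : 0 < e / (4 * W) by rewrite divr_gt0 // mulr_gt0.
have r0 : 0 < r by rewrite sqrtr_gt0.
have r0' : 0 < r%:C by rewrite ltcR.
have [[a b] /= [[Ta ->] [/= ya zb]]] := cl _ (nbhsx_ballx (y, z) _ r0').
move: ya zb; rewrite -!ball_normE /= !normr_lt_sqnorm //.
rewrite (sqr_sqrtr (ltW eW0)) => ya zb.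
have -> : rinner (T x) y - rinner x z =
    rinner (T x) (y - a) - rinner x (z - T a).
  by rewrite !rinnerDr !rinnerNr (formal_adjoint_rinner TT Tx Ta); lra.
have eW : 4 * (e / (4 * W) * W) = e by field; rewrite gt_eqF.
move: (rinner_sqr_le (T x) (y - a)) (rinner_sqr_le x (z - T a)).
move: (rinner (T x) (y - a)) (rinner x (z - T a)) => p q hp hq.
have hp' : p ^+ 2 <= W * (e / (4 * W)).
  apply: le_trans hp _; apply: ler_pM; rewrite ?sqnorm_ge0 ?ltW //.
  by rewrite /W; have := sqnorm_ge0 x; lra.
have hq' : q ^+ 2 <= W * (e / (4 * W)).
  apply: le_trans hq _; apply: ler_pM; rewrite ?sqnorm_ge0 ?ltW //.
  by rewrite /W; have := sqnorm_ge0 (T x); lra.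
have := sqr_ge0 (p + q); lra.
Qed.

(** T + i is onto, since (T + i)(T - i) = 1 + T^2 is. *)
Lemma self_adjoint_surj T w : self_adjoint T ->
  exists2 x, dom T x & T x + 'i%C *: x = w.
Proof.
move=> saT; have cT := self_adjoint_closed saT; have [dT [Td Te]] := saT.
have [K resK] := resolvent_exists dT cT.
have [Tp T'p pE] := resK w; move: T'p; rewrite -Td => TTp.
rewrite -Te // in pE; have [Tip ipE] := opZ 'i%C Tp.
have [Tx xE] := opB TTp Tip.
exists (T (K w) - 'i%C *: K w) => //.
rewrite xE ipE scalerBr scalerA -expr2 sqr_i scaleN1r opprK addrA subrK.
by rewrite addrC.
Qed.

End SelfAdjoint.

(** * Maximality of self-adjoint operators below AB *)

Lemma bounded_sqnorm (R : realType) (H : hilbertType R) (C : H -> H) (m : R) :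
  (forall x, `|C x| <= m%:C * `|x|) ->
  forall x, sqnorm (C x) <= m ^+ 2 * sqnorm x.
Proof.
move=> Cm x; rewrite -lecR (rmorphM (real_complex R)).
rewrite (rmorphXn (real_complex R)) /=.
rewrite !sqnormE -exprMn.
by apply: lerXn2r; rewrite ?nnegrE ?normr_ge0 //; exact: le_trans (Cm x).
Qed.

Theorem theorem3p13 (R : realType) (H : hilbertType R) (A B T : operator H)
    (B_normal : normal_op B) (A_sym : symmetric_op A) (A_inv : invertible_op A)
    (T_sa : self_adjoint T) :
  op_sub T (op_comp A B) -> op_eq T (op_comp A B).
Proof.
move=> [TAB TABe].
have [dA [AAd AAe]] := A_sym.
have AA : formal_adjoint A A.
  move=> x y Ax Ay; rewrite (AAe y) //; apply: adjoint_formal => //; exact: AAd.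
have [C0 [[C0d [m C0m]] [_ CA] [AC0 ACe]]] := A_inv.
have C0T x : dom C0 x by rewrite C0d.
have linC : linear C0 by move=> a x y; exact: app_lin.
pose C : {linear H -> H} := HB.pack (C0 : H -> H)
  (GRing.isLinear.Build _ _ _ _ (C0 : H -> H) linC).
have AC x : dom A (C x) /\ A (C x) = x.
  have d : dom (op_comp A C0) x by rewrite AC0.
  by split; [case: d | exact: ACe].
have CA' x : dom A x -> C (A x) = x by move=> Ax; apply: (CA x).
have Csa x y : rinner (C x) y = rinner x (C y).
  have [Ax xE] := AC x; have [Ay yE] := AC y.
  by rewrite -{1}yE -(formal_adjoint_rinner AA) // xE.
have CM := bounded_sqnorm C0m.
have [dB [cB nB]] := B_normal; pose B' := adjoint dB.
have [K resK] := resolvent_exists dB cB.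
have TT := self_adjoint_formal T_sa.
have BB' : formal_adjoint B B' by apply: adjoint_formal.
(* C B^* <= B C: the vector C y lies in D(T^* ) = D(T). *)
have CB y : dom B' y -> dom B (C y) /\ B (C y) = C (B' y).
  move=> B'y; have [ACy ACyE] := AC y.
  have [Tx xE] : dom T (C y) /\ T (C y) = B' y.
    apply: (self_adjoint_adj_rel T_sa) => t Tt.
    have [Bt ABt] := TAB _ Tt.
    by rewrite TABe //= AA // ACyE BB'.
  have [Bx ABx] := TAB _ Tx; split=> //.
  by rewrite -xE (TABe _ Tx); exact: esym (CA' _ ABx).
split; last exact: TABe.
apply/seteqP; split; first exact: TAB.
move=> x [Bx ABx].
have [x' Tx' x'E] := self_adjoint_surj (A (B x) + 'i%C *: x) T_sa.
have [Bx' ABx'] := TAB _ Tx'.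
have [Bz BzE] := opB Bx Bx'; have [ABz ABzE] := opB ABx ABx'.
set z := x - x' in Bz BzE.
(* (AB + i) z = 0. *)
have zE : B z = - ('i%C *: C z).
  rewrite -(CA' (B z)) BzE // ABzE -[A (B x')](TABe _ Tx').
  have -> : A (B x) - T x' = - ('i%C *: z).
    rewrite /z scalerBr opprB; apply/eqP; rewrite subr_eq.
    by rewrite addrAC -subr_eq opprK eq_sym addrC x'E.
  by rewrite linearN linearZ.
have Cz0 : C z = 0.
  exact: (@intertwine_eigen R H B B' K C (m ^+ 2) BB' resK nB (sqr_ge0 m) CM
    Csa CB z Bz zE).
have : z = 0 by have [_ <-] := AC z; rewrite Cz0 app0.
by move=> /eqP; rewrite subr_eq0 => /eqP ->.
Qed.
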